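(* Let $b$ be a connected graph over $X$, let $q:X\to\mathbb{R}$ be a potential and let $o\in X$. Let $w\in C(X)$ with $w\ge0$, $w\neq0$, be such that $h-w\ge0$ on $C_c(X)$ and $h-w$ is critical in $X$, and let $\psi$ be the corresponding ground state of $h-w$ normalized at $o$. Then the following statements are equivalent: (i) $h-w$ is positive-critical with respect to $w$, that is, $\psi\in\ell^2(X,w)$. (ii) $\psi\in D_{h,o}$. (iii) $\psi\in D_{h,o}\cap\ell^2(X,w)$. (iv) There is $v\in D_{h,o}\cap\ell^2(X,w)$ such that $$\frac{\overline h(v)}{\|v\|_w^2}=\inf_{\varphi\in C_c(X)}\frac{h(\varphi)}{\|\varphi\|_w^2}.$$ (v) $\psi\in D_{h,o}\cap\ell^2(X,w)$ and $$\frac{\overline h(\psi)}{\|\psi\|_w^2}=\inf_{\varphi\in C_c(X)}\frac{h(\varphi)}{\|\varphi\|_w^2}.$$ Furthermore, if $w$ is strictly positive, then also the following statement is equivalent: (vi) $\psi$ is an eigenfunction of the operator $(H-w)^{(w)}$ with eigenvalue $0$.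
   Context: $X$ is an infinite set with the discrete topology. A graph over $X$ is a symmetric function $b:X\times X\to[0,\infty)$ with zero diagonal such that $\sum_{y\in X}b(x,y)<\infty$ for all $x\in X$; it is connected if any two vertices are joined by a finite path $x_0,\dots,x_n$ with $b(x_i,x_{i+1})>0$. $C(X)$ is the space of real valued functions on $X$ and $C_c(X)$ the subspace of finitely supported functions. Let $F(X)=\{f\in C(X)\mid \sum_{y}b(x,y)|f(y)|<\infty \text{ for all } x\in X\}$, and for $f\in F(X)$ let $Hf(x)=\sum_{y}b(x,y)(f(x)-f(y))+q(x)f(x)$. The form $h$ on $C_c(X)$ is $h(\varphi)=\frac12\sum_{x,y}b(x,y)(\varphi(x)-\varphi(y))^2+\sum_x q(x)\varphi(x)^2$. For $w\in C(X)$, $(h-w)(\varphi)=h(\varphi)-\sum_xw(x)\varphi(x)^2$; this is the form associated with the formal operator $H-w$ (potential $q-w$). A form is $\ge0$ on $C_c(X)$ if its value is $\ge0$ for every $\varphi\in C_c(X)$. A form $a\ge0$ on $C_c(X)$ of this type is subcritical in $X$ if there is $w'\in C(X)$, $w'\ge0$, $w'\ne0$, with $a-w'\ge0$ on $C_c(X)$; otherwise it is critical. If $a$ (with formal operator $A$) is critical, then up to scaling there is a unique function $u\in F(X)$, $u\ge0$, $u\neq0$ with $Au\ge0$ on $X$; it is strictly positive and satisfies $Au=0$. The ground state of $a$ normalized at $o$ is this function with value $1$ at $o$. The critical form $a$ with ground state $\psi$ is positive-critical with respect to $w$ if $\sum_X\psi^2w<\infty$, and null-critical if $\sum_X\psi^2w=\infty$.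 $\|f\|_w=\left(\sum_xw(x)f(x)^2\right)^{1/2}$, which is in general a seminorm, and $\ell^2(X,w)=\{f\in C(X)\mid\|f\|_w<\infty\}$. Quotients with denominator $\|\cdot\|_w^2$ are considered only for functions with $\|\cdot\|_w\neq0$. If $w$ is strictly positive, the form $h-w\ge 0$ is closable in $\ell^2(X,w)$, and $(H-w)^{(w)}$ denotes the selfadjoint operator in $\ell^2(X,w)$ associated with its closure. For $o\in X$ let $\|\varphi\|_{h,o}=\sqrt{h(\varphi)+\varphi(o)^2}$ (note $h\ge 0$ since $h\ge w\ge 0$), a norm on $C_c(X)$; convergence in it implies pointwise convergence. $D_{h,o}\subset C(X)$ is the completion of $C_c(X)$ with respect to $\|\cdot\|_{h,o}$, realized as the space of pointwise limits of $\|\cdot\|_{h,o}$-Cauchy sequences in $C_c(X)$. For $f\in D_{h,o}$ the limit of such a sequence $(\varphi_n)$, $\overline h(f)=\lim_n h(\varphi_n)$. *)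

(* Defs.v *)
From HB Require Import structures.
From mathcomp Require Import all_boot all_order all_algebra.
From mathcomp Require Import all_classical all_reals all_analysis.
Import Order.TTheory GRing.Theory Num.Theory.
Import numFieldNormedType.Exports.

Set Implicit Arguments.
Unset Strict Implicit.
Unset Printing Implicit Defensive.

Local Open Scope classical_set_scope.
Local Open Scope ring_scope.

Section Definitions.
Context {R : realType} {X : choiceType}.
Implicit Types (b : X -> X -> R) (q p w f g u v psi phi : X -> R) (o x y : X).
Implicit Types (a : (X -> R) -> R) (Phi : nat -> X -> R).

(* [esum] is only meaningful for nonnegative terms, so that a signed,
   absolutely convergent sum is the sum of the positive parts minus the sum of
   the negative parts. *)
Definition rsum f : R :=
  fine (\esum_(x in setT) (EFin \o f)^\+ x - \esum_(x in setT) (EFin \o f)^\- x)%E.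

Record is_graph b : Prop := IsGraph {
  graph_ge0 : forall x y, 0 <= b x y;
  graph_sym : forall x y, b x y = b y x;
  graph_diag : forall x, b x x = 0;
  graph_sum : forall x, (\esum_(y in setT) (b x y)%:E < +oo)%E }.

Definition graph_connected b : Prop :=
  forall x y, exists s : seq X, path (fun x y => 0 < b x y) x s /\ last x s = y.

Definition Cc : set (X -> R) := [set phi | finite_set [set x | phi x != 0]].

Definition formal_domain b : set (X -> R) :=
  [set f | forall x, (\esum_(y in setT) (b x y * `|f y|)%:E < +oo)%E].

Definition formal_op b p f : X -> R :=
  fun x => rsum (fun y => b x y * (f x - f y)) + p x * f x.

(* The form with graph [b] and potential [p], for [phi] in [Cc].  The form
   [h - w] is the one with potential [q - w], see [graph_form_potentialB]. *)
Definition graph_form b p phi : R :=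
  2^-1 * fine (\esum_(z in [set: X * X])
                 (b z.1 z.2 * (phi z.1 - phi z.2) ^+ 2)%:E)
  + \sum_(x \in setT) p x * phi x ^+ 2.

Lemma graph_form_potentialB b q w phi : Cc phi ->
  graph_form b (fun x => q x - w x) phi =
  graph_form b q phi - \sum_(x \in setT) w x * phi x ^+ 2.
Proof.
move=> fphi; rewrite /graph_form -addrA; congr (_ + _).
have fin : finite_set [set x | phi x != 0] := fphi.
have E p : \sum_(x \in setT) p x * phi x ^+ 2 =
    \sum_(x \in [set x | phi x != 0]) p x * phi x ^+ 2.
  apply/esym/fsbig_widen => // x /= [_ /negP/negPn/eqP ->].
  by rewrite expr0n/= mulr0.
rewrite !E !fsbig_finite//= -sumrB.
by apply: eq_bigr => x _; rewrite mulrBl.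
Qed.

Definition Cc_nonneg a : Prop := forall phi, Cc phi -> 0 <= a phi.

Definition subcritical b p : Prop :=
  exists w', [/\ forall x, 0 <= w' x, w' <> cst 0 &
                 Cc_nonneg (graph_form b (fun x => p x - w' x))].

Definition critical b p : Prop := Cc_nonneg (graph_form b p) /\ ~ subcritical b p.

Definition is_ground_state b p o u : Prop :=
  [/\ formal_domain b u, forall x, 0 <= u x, u <> cst 0,
      forall x, 0 <= formal_op b p u x & u o = 1].

Definition wnorm2 w f : \bar R := (\esum_(x in setT) (w x * f x ^+ 2)%:E)%E.

Definition ell2 w : set (X -> R) := [set f | (wnorm2 w f < +oo)%E].

(* For [f] in [ell2 w]. *)
Definition wnorm w f : R := Num.sqrt (fine (wnorm2 w f)).

Definition wdot w f g : R := rsum (fun x => w x * f x * g x).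

Definition positive_critical b p o psi w : Prop :=
  [/\ critical b p, is_ground_state b p o psi &
      (\esum_(x in setT) (psi x ^+ 2 * w x)%:E < +oo)%E].

Definition cauchy_for (nrm : (X -> R) -> R) Phi : Prop :=
  forall e : R, 0 < e -> exists N : nat, forall m n : nat,
    (N <= m)%N -> (N <= n)%N -> nrm (fun x => Phi m x - Phi n x) < e.

Definition form_norm a o phi : R := Num.sqrt (a phi + phi o ^+ 2).

Definition D_approx a o Phi f : Prop :=
  [/\ forall n, Cc (Phi n), cauchy_for (form_norm a o) Phi &
      forall x, (fun n => Phi n x) @ \oo --> f x].

Definition D_space a o : set (X -> R) := [set f | exists Phi, D_approx a o Phi f].

(* The limit does not depend on the sequence when [a >= 0] and
   [form_norm]-convergence implies pointwise convergence. *)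
Definition form_ext a o f : R :=
  get [set l : R | exists Phi, D_approx a o Phi f /\ a \o Phi @ \oo --> l].

Definition rayleigh_inf a w : R :=
  inf [set a phi / wnorm w phi ^+ 2 | phi in [set phi | Cc phi /\ wnorm w phi != 0]].

(* The closure in [ell2 w] of the form [a] on [Cc], and the selfadjoint operator
   associated with it by the representation theorem. *)
Definition closure_norm a w phi : R := Num.sqrt (a phi + wnorm w phi ^+ 2).

Definition closure_approx a w Phi f : Prop :=
  [/\ ell2 w f, forall n, Cc (Phi n), cauchy_for (closure_norm a w) Phi &
      (fun n => wnorm w (fun x => Phi n x - f x)) @ \oo --> (0 : R)].

Definition closure_dom a w : set (X -> R) :=
  [set f | exists Phi, closure_approx a w Phi f].

Definition closure_form a w f : R :=
  get [set l : R | exists Phi, closure_approx a w Phi f /\ a \o Phi @ \oo --> l].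

Definition closure_bilin a w f g : R :=
  4^-1 * (closure_form a w (fun x => f x + g x)
          - closure_form a w (fun x => f x - g x)).

(* The graph of the operator: [f] is in its domain and is mapped to [g]. *)
Definition assoc_op a w f g : Prop :=
  [/\ closure_dom a w f, ell2 w g &
      forall k, closure_dom a w k -> closure_bilin a w f k = wdot w g k].

Definition eigenfunction a w (lambda : R) f : Prop :=
  f <> cst 0 /\ assoc_op a w f (fun x => lambda * f x).

End Definitions.

(* Main.v *)
Require Import Defs.
From HB Require Import structures.
From mathcomp Require Import all_boot all_order all_algebra.
From mathcomp Require Import all_classical all_reals all_analysis.
From mathcomp Require Import ring lra.
Import Order.TTheory GRing.Theory Num.Theory.
Import numFieldNormedType.Exports.
Set Implicit Arguments.
Unset Strict Implicit.
Unset Printing Implicit Defensive.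
Local Open Scope classical_set_scope.
Local Open Scope ring_scope.

(** Everything rests on the ground state representation. Write [a] for the form
    [h - w] and [A] for its formal operator. For a strictly positive [f] in the
    formal domain and [phi] in
    [Cc], [a phi] is the sum of the energy [1/2 sum_(x, y) b x y * f x * f y *
    (phi x / f x - phi y / f y)^2] and of [sum_x (A f x / f x) * phi x ^ 2]
    (lemma [ground_state_representation]). The ground state [psi] is strictly
    positive because its zero set spreads along edges, and [A psi = 0], since
    otherwise [A psi / psi] could be subtracted from the critical form. Hence
    on [Cc] the form [a] is the squared norm of [phi / psi], differentiated
    along edges, in a weighted l^2 space over [X * X], and [h] is obtained by
    adding the squared norm of [phi] in the l^2 space with weight [w].

    Both are weighted l^2 norms of functions that depend continuously on the
    pointwise values of [phi]. In such a space a Cauchy sequence converges in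
    norm to its pointwise limit, by Fatou's lemma ([cauchy_wnorm_cvg]). So the
    extension of [h] to [D_space] and the closure of [a] are given by the same
    two norms, now for the limit function ([form_extE], [closure_formE]). In
    particular [psi] has energy zero, and every function of energy zero is a
    multiple of [psi] ([zero_energy_multiple]).

    Criticality gives two more facts. As no positive multiple of the indicator
    of [o] can be subtracted from [a], there are [phi] in [Cc] with [phi o = 1]
    and arbitrarily small energy; truncated to lie between [0] and [psi] they
    form a sequence that converges pointwise to [psi] ([null_sequence]). As no
    positive multiple of [w] can be subtracted, the infimum of the Rayleigh
    quotients is [1] ([rayleigh_infE]).

    The equivalences follow. If [psi] is in l^2, then by dominated convergence
    the null sequence converges to it in both norms, so [psi] is in [D_space]
    and in the domain of the closure. Conversely functions in [D_space] are in
    l^2 by Fatou's lemma. The quotient at [psi] is [(0 + ||psi||^2) / ||psi||^2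
    = 1], and a minimiser has energy zero, hence is a nonzero multiple of
    [psi]. Finally the energies of [psi + k] and [psi - k] both equal that of
    [k], so by polarisation [psi] is annihilated by the operator associated
    with [a]. *)

(** * Weighted l^2 spaces *)

Section WeightedL2.
Context {R : realType} {I : choiceType} (c : I -> R).
Hypothesis c_ge0 : forall i, 0 <= c i.
Implicit Types (u v f g : I -> R) (U : nat -> I -> R).

Let term_ge0 u i : 0 <= c i * u i ^+ 2.
Proof. by rewrite mulr_ge0// sqr_ge0. Qed.

Lemma wnorm2_ge0 u : (0 <= wnorm2 c u)%E.
Proof. by apply: esum_ge0 => i _; rewrite lee_fin. Qed.

Lemma wnorm_ge0 u : 0 <= wnorm c u.
Proof. exact: sqrtr_ge0. Qed.

Lemma ell2E u : ell2 c u -> wnorm2 c u = (wnorm c u ^+ 2)%:E.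
Proof.
move=> u2; rewrite /wnorm sqr_sqrtr ?fine_ge0 ?wnorm2_ge0// fineK//.
by rewrite ge0_fin_numE// wnorm2_ge0.
Qed.

Lemma fsum_le_wnorm2 (A : set I) u : finite_set A ->
  ((\sum_(i \in A) c i * u i ^+ 2)%:E <= wnorm2 c u)%E.
Proof.
move=> fA; apply: ereal_sup_ubound; exists A => //.
by rewrite fsumEFin.
Qed.

Lemma wnorm2_le_fsum u (M : \bar R) :
  (forall A, finite_set A -> ((\sum_(i \in A) c i * u i ^+ 2)%:E <= M)%E) ->
  (wnorm2 c u <= M)%E.
Proof.
by move=> uM; apply: ge_ereal_sup => _ [A [fA _] <-]; rewrite fsumEFin// uM.
Qed.

Lemma term_le_wnorm i u : ell2 c u -> c i * u i ^+ 2 <= wnorm c u ^+ 2.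
Proof.
move=> u2; rewrite -lee_fin -ell2E//.
by apply: le_trans (fsum_le_wnorm2 u (finite_set1 i)); rewrite fsbig_set1.
Qed.

(** Monotonicity, scaling and Minkowski's inequality all follow from such a
    pointwise comparison of squares, so that finite partial sums are handled
    only here. *)
Lemma wnorm_dom (k l : R) u v f : 0 <= k -> 0 <= l -> ell2 c u -> ell2 c v ->
  (forall i, f i ^+ 2 <= k * u i ^+ 2 + l * v i ^+ 2) ->
  ell2 c f /\ wnorm c f ^+ 2 <= k * wnorm c u ^+ 2 + l * wnorm c v ^+ 2.
Proof.
move=> k0 l0 u2 v2 fuv.
have le : (wnorm2 c f <= (k * wnorm c u ^+ 2 + l * wnorm c v ^+ 2)%:E)%E.
  apply: wnorm2_le_fsum => A fA; rewrite lee_fin.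
  have := fsum_le_wnorm2 u fA; have := fsum_le_wnorm2 v fA.
  rewrite !ell2E// !lee_fin => vA uA.
  apply: le_trans (lerD (ler_wpM2l k0 uA) (ler_wpM2l l0 vA)).
  rewrite !fsbig_finite//= !mulr_sumr -big_split/=; apply: ler_sum => i _.
  by rewrite !(mulrCA _ (c i)) -mulrDr ler_wpM2l.
have f2 : ell2 c f by rewrite /ell2/= (le_lt_trans le)// ltry.
by split=> //; rewrite -lee_fin -ell2E.
Qed.

Lemma wnorm_le u f : ell2 c u -> (forall i, `|f i| <= `|u i|) ->
  ell2 c f /\ wnorm c f <= wnorm c u.
Proof.
move=> u2 fu; have [i|f2 le] := @wnorm_dom 1 0 u u f ler01 (lexx _) u2 u2.
  rewrite mul0r addr0 mul1r -(real_normK (num_real (f i))).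
  by rewrite -(real_normK (num_real (u i))) ler_sqr ?nnegrE.
by split=> //; move: le; rewrite mul0r addr0 mul1r ler_sqr ?nnegrE ?wnorm_ge0.
Qed.

Lemma eq_wnorm u f : (forall i, `|f i| = `|u i|) -> wnorm c f = wnorm c u.
Proof.
move=> fu; rewrite /wnorm; congr (Num.sqrt (fine _)); apply: eq_esum => i _.
by rewrite -(real_normK (num_real (f i))) fu real_normK ?num_real.
Qed.

Lemma wnorm_scale (k : R) u : ell2 c u ->
  ell2 c (fun i => k * u i) /\ wnorm c (fun i => k * u i) <= `|k| * wnorm c u.
Proof.
move=> u2; have [|i|f2 le] := @wnorm_dom (k ^+ 2) 0 u u (fun i => k * u i)
  _ (lexx _) u2 u2; rewrite ?sqr_ge0//.
  by rewrite mul0r addr0 exprMn.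
split=> //; rewrite -ler_sqr ?nnegrE ?mulr_ge0 ?wnorm_ge0//.
by rewrite exprMn real_normK ?num_real// (le_trans le)// mul0r addr0.
Qed.

(** Minkowski: optimising over [t] in
    [(x + y)^2 <= (1 + t) x^2 + (1 + 1/t) y^2], with the norms fattened by [d]
    so that the optimal [t] is defined. *)
Lemma wnormD u v : ell2 c u -> ell2 c v ->
  ell2 c (fun i => u i + v i) /\
  wnorm c (fun i => u i + v i) <= wnorm c u + wnorm c v.
Proof.
move=> u2 v2; set f := fun i => _.
have amgm (t : R) i : 0 < t ->
    f i ^+ 2 <= (1 + t) * u i ^+ 2 + (1 + t^-1) * v i ^+ 2.
  move=> t0; rewrite -subr_ge0 /f.
  have -> : (1 + t) * u i ^+ 2 + (1 + t^-1) * v i ^+ 2 - (u i + v i) ^+ 2 =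
      t^-1 * (t * u i - v i) ^+ 2 by field; rewrite gt_eqF.
  by rewrite mulr_ge0 ?sqr_ge0// invr_ge0 ltW.
have main (t : R) : 0 < t -> ell2 c f /\
    wnorm c f ^+ 2 <= (1 + t) * wnorm c u ^+ 2 + (1 + t^-1) * wnorm c v ^+ 2.
  move=> t0; apply: wnorm_dom => //; last by move=> i; exact: amgm.
    by rewrite addr_ge0 ?ltW.
  by rewrite addr_ge0 ?invr_ge0 ?ltW.
split; first exact: (main 1 ltr01).1.
apply/ler_addgt0Pr => e e0; set d := e / 2.
have d0 : 0 < d by rewrite divr_gt0.
set A := wnorm c u + d; set B := wnorm c v + d.
have A0 : 0 < A by rewrite ltr_wpDl ?wnorm_ge0.
have B0 : 0 < B by rewrite ltr_wpDl ?wnorm_ge0.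
have -> : wnorm c u + wnorm c v + e = A + B by rewrite /A /B /d; field.
have AB0 : 0 <= A + B := addr_ge0 (ltW A0) (ltW B0).
rewrite -ler_sqr ?nnegrE ?wnorm_ge0//.
apply: (le_trans (main (B / A) (divr_gt0 B0 A0)).2).
have -> : (A + B) ^+ 2 = (1 + B / A) * A ^+ 2 + (1 + (B / A)^-1) * B ^+ 2.
  by field; rewrite !gt_eqF.
apply: lerD; apply: ler_wpM2l.
- by rewrite addr_ge0// divr_ge0 ?ltW.
- by rewrite ler_sqr ?nnegrE ?wnorm_ge0 ?(ltW A0)// lerDl ltW.
- by rewrite addr_ge0// invr_ge0 divr_ge0 ?ltW.
- by rewrite ler_sqr ?nnegrE ?wnorm_ge0 ?(ltW B0)// lerDl ltW.
Qed.

Lemma wnormN u : wnorm c (fun i => - u i) = wnorm c u.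
Proof. by apply: eq_wnorm => i; rewrite normrN. Qed.

Lemma ell2N u : ell2 c u -> ell2 c (fun i => - u i).
Proof.
by move=> /wnorm_le H; case: (H (fun i => - u i)) => // i; rewrite normrN.
Qed.

Lemma wnormB u v : ell2 c u -> ell2 c v ->
  ell2 c (fun i => u i - v i) /\
  wnorm c (fun i => u i - v i) <= wnorm c u + wnorm c v.
Proof. by move=> u2 /ell2N v2; rewrite -(wnormN v); exact: wnormD. Qed.

Lemma wnorm_dist u v : ell2 c u -> ell2 c v ->
  `|wnorm c u - wnorm c v| <= wnorm c (fun i => u i - v i).
Proof.
move=> u2 v2; have [d2 _] := wnormB u2 v2.
have [_ h1] := wnormD d2 v2; have [_ h2] := wnormB u2 d2.
have e1 : wnorm c (fun i => u i - v i + v i) = wnorm c u.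
  by apply: eq_wnorm => i; rewrite subrK.
have e2 : wnorm c (fun i => u i - (u i - v i)) = wnorm c v.
  by apply: eq_wnorm => i; rewrite subKr.
rewrite e1 in h1; rewrite e2 in h2.
by rewrite ler_norml; apply/andP; split; lra.
Qed.

(** Fatou: every finite partial sum passes to the limit, and the norm is their
    supremum. *)
Lemma wnorm2_lsc U u (m : \bar R) : (forall i, U n i @[n --> \oo] --> u i) ->
  (m < wnorm2 c u)%E -> \forall n \near \oo, (m < wnorm2 c (U n))%E.
Proof.
move=> Uu /ereal_sup_gt[_ [A [fA _] <-]]; rewrite fsumEFin// => mA.
have cvA : \sum_(i \in A) c i * U n i ^+ 2 @[n --> \oo] -->
    \sum_(i \in A) c i * u i ^+ 2.
  rewrite fsbig_finite//=; under eq_fun do rewrite fsbig_finite//=.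
  apply: cvg_big => [|i _]; first exact: add_continuous.
  apply: cvgM; first exact: cvg_cst.
  by under eq_fun do rewrite expr2; rewrite expr2; exact: cvgM.
case: m mA => [m| |].
- rewrite lte_fin => mA; near=> n.
  apply: lt_le_trans (fsum_le_wnorm2 (U n) fA); rewrite lte_fin.
  by near: n; exact: cvgr_gt mA.
- by [].
- by move=> _; near=> n; rewrite (lt_le_trans _ (wnorm2_ge0 _)).
Unshelve. all: by end_near. Qed.

Lemma wnorm_fatou U u (m : R) : (forall i, U n i @[n --> \oo] --> u i) ->
  (\forall n \near \oo, ell2 c (U n) /\ wnorm c (U n) <= m) ->
  ell2 c u /\ wnorm c u <= m.
Proof.
move=> Uu Um.
have m0 : 0 <= m.
  near \oo => n; rewrite (le_trans (wnorm_ge0 (U n)))//; near: n.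
  by apply: filterS Um => n [].
have le : (wnorm2 c u <= (m ^+ 2)%:E)%E.
  rewrite leNgt; apply/negP => /(wnorm2_lsc Uu) Ugt.
  near \oo => n; have : ((m ^+ 2)%:E < wnorm2 c (U n))%E by near: n.
  have [U2 Ule] : ell2 c (U n) /\ wnorm c (U n) <= m by near: n.
  by rewrite ell2E// lte_fin ltNge ler_sqr ?nnegrE ?wnorm_ge0// Ule.
have u2 : ell2 c u by rewrite /ell2/= (le_lt_trans le)// ltry.
by split=> //; move: le; rewrite ell2E// lee_fin ler_sqr ?nnegrE ?wnorm_ge0.
Unshelve. all: by end_near. Qed.

Lemma wnorm_cvg U u : (forall n, ell2 c (U n)) -> ell2 c u ->
  wnorm c (fun i => U n i - u i) @[n --> \oo] --> (0 : R) ->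
  wnorm c (U n) @[n --> \oo] --> wnorm c u.
Proof.
move=> U2 u2 U0; apply/cvgrPdist_le => e e0; near=> n.
rewrite distrC (le_trans (wnorm_dist _ _))//.
by near: n; have /cvgrPdist_le/(_ e e0) := U0;
  apply: filterS => n; rewrite sub0r normrN ger0_norm ?wnorm_ge0.
Unshelve. all: by end_near. Qed.

(** Applying Fatou to [m |-> U m - U n] bounds the distance to the pointwise
    limit by the Cauchy modulus. *)
Lemma cauchy_wnorm_cvg U u : (forall i, U n i @[n --> \oo] --> u i) ->
  (forall n, ell2 c (U n)) -> cauchy_for (wnorm c) U ->
  ell2 c u /\ wnorm c (fun i => U n i - u i) @[n --> \oo] --> (0 : R).
Proof.
move=> Uu U2 Uc.
have main (e : R) : 0 < e -> \forall n \near \oo,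
    ell2 c (fun i => U n i - u i) /\ wnorm c (fun i => U n i - u i) <= e.
  move=> e0; have [N UN] := Uc e e0; near=> n.
  apply: (@wnorm_fatou (fun m i => U n i - U m i)) => [i|].
    by apply: cvgB => //; exact: cvg_cst.
  near=> m; split; first exact: (wnormB _ _).1.
  by apply/ltW/UN; [near: n|near: m]; exact: nbhs_infty_ge.
split.
  near \oo => n; have [d2 _] : ell2 c (fun i => U n i - u i) /\
    wnorm c (fun i => U n i - u i) <= 1 by near: n; exact: main.
  have [+ _] := wnormB (U2 n) d2; congr (ell2 _ _); apply/funext => i.
  by rewrite subKr.
apply/cvgrPdist_le => e e0; apply: filterS (main e e0) => n [_].
by rewrite sub0r normrN ger0_norm ?wnorm_ge0.
Unshelve. all: by end_near. Qed.

(** Dominated convergence: [(u - U n) ^ 2 <= u ^ 2 - (U n) ^ 2], so the squared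
    distance to [u] is at most the defect in Fatou's inequality. *)
Lemma dominated_wnorm_cvg U u : ell2 c u ->
  (forall n i, 0 <= U n i <= u i) -> (forall i, U n i @[n --> \oo] --> u i) ->
  wnorm c (fun i => U n i - u i) @[n --> \oo] --> (0 : R).
Proof.
move=> u2 Ule Uu.
have U2 n : ell2 c (U n).
  apply: (wnorm_le u2 _).1 => i; have /andP[U0 Uui] := Ule n i.
  by rewrite !ger0_norm// (le_trans U0).
have defect n : wnorm c (fun i => U n i - u i) ^+ 2 + wnorm c (U n) ^+ 2 <=
    wnorm c u ^+ 2.
  rewrite -lee_fin EFinD -!ell2E//; last exact: (wnormB _ _).1.
  rewrite -esumD; do ?by move=> i _; rewrite lee_fin mulr_ge0 ?sqr_ge0.
  apply: le_esum => i _; rewrite -EFinD lee_fin -mulrDr ler_wpM2l//.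
  have /andP[U0 Uui] := Ule n i; nra.
apply/cvgrPdist_le => e e0; near=> n.
rewrite sub0r normrN ger0_norm ?wnorm_ge0//.
rewrite -ler_sqr ?nnegrE ?wnorm_ge0 ?(ltW e0)//.
have : ((wnorm c u ^+ 2 - e ^+ 2)%:E < wnorm2 c (U n))%E.
  near: n; apply: wnorm2_lsc Uu _; rewrite ell2E// lte_fin.
  by rewrite ltrBlDr ltrDl exprn_gt0.
rewrite ell2E// lte_fin; have := defect n; lra.
Unshelve. all: by end_near. Qed.

Lemma norm_le_wnorm i u : 0 < c i -> ell2 c u ->
  `|u i| <= wnorm c u / Num.sqrt (c i).
Proof.
move=> ci u2; have sci : 0 < Num.sqrt (c i) by rewrite sqrtr_gt0.
rewrite ler_pdivlMr// -ler_sqr ?nnegrE ?mulr_ge0 ?wnorm_ge0 ?(ltW sci)//.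
rewrite exprMn real_normK ?num_real// sqr_sqrtr ?(ltW ci)// mulrC.
exact: term_le_wnorm.
Qed.

Lemma wnorm_cvg0 U i : 0 < c i -> (forall n, ell2 c (U n)) ->
  wnorm c (U n) @[n --> \oo] --> (0 : R) -> U n i @[n --> \oo] --> (0 : R).
Proof.
move=> ci U2 U0; apply: norm_cvg0.
apply: (@squeeze_cvgr _ _ _ _ (cst 0) (fun n => wnorm c (U n) / Num.sqrt (c i))).
- by near=> n; rewrite normr_ge0 norm_le_wnorm.
- exact: cvg_cst.
- by rewrite -(mul0r (Num.sqrt (c i))^-1); apply: cvgM => //; exact: cvg_cst.
Unshelve. all: by end_near. Qed.

End WeightedL2.

(** * Sums with finite support *)

Section FiniteSupport.
Context {R : realType} {X : choiceType}.
Implicit Types (g s t : X -> R) (phi : X -> R).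

Lemma fsum_supp g s : \sum_(x \in setT) g x * s x =
  \sum_(x \in [set x | g x != 0]) g x * s x.
Proof.
by apply/esym/fsbig_widen => // x /= [_ /negP/negPn/eqP ->]; rewrite mul0r.
Qed.

Lemma fsumD g s t : Cc g -> \sum_(x \in setT) g x * (s x + t x) =
  \sum_(x \in setT) g x * s x + \sum_(x \in setT) g x * t x.
Proof.
move=> fg; rewrite !fsum_supp -fsbig_split//.
by apply: eq_fsbigr => x _; rewrite mulrDr.
Qed.

Lemma fsumB g s t : Cc g -> \sum_(x \in setT) g x * (s x - t x) =
  \sum_(x \in setT) g x * s x - \sum_(x \in setT) g x * t x.
Proof.
move=> fg; rewrite fsumD// -mulN1r mulr_fsumr; congr (_ + _).
by apply: eq_fsbigr => x _; rewrite mulN1r mulrN.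
Qed.

Lemma Cc_sqr phi : Cc phi -> Cc (fun x => phi x ^+ 2).
Proof. by apply: sub_finite_set => x /=; rewrite expf_eq0. Qed.

Lemma esum_finite_support g s : Cc g -> (forall x, 0 <= g x * s x) ->
  (\esum_(x in setT) (g x * s x)%:E)%E = (\sum_(x \in setT) g x * s x)%:E.
Proof.
move=> fg gs; rewrite fsum_supp -fsumEFin//.
rewrite -esum_fset => [|//|x _]; last by rewrite lee_fin.
rewrite [RHS]esum_mkcond; apply: eq_esum => x _.
case: ifPn => // /negP; rewrite inE/= => /negP/negPn/eqP ->.
by rewrite mul0r.
Qed.

Lemma esumZ (k : R) (a : X -> R) : 0 <= k -> (forall x, 0 <= a x) ->
  (\esum_(x in setT) (k * a x)%:E)%E = (k%:E * \esum_(x in setT) (a x)%:E)%E.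
Proof.
move=> k0 a0; rewrite /esum -ereal_supZl//; last first.
  by apply/set0P; exists (\sum_(x \in set0) (a x)%:E)%E; exists set0 => //;
    exact: fsets_set0.
congr ereal_sup; rewrite image_comp; apply: eq_imagel => A [fA _] /=.
rewrite ge0_mule_fsumr => [|x]; last by rewrite lee_fin.
by apply: eq_fsbigr => x _; rewrite EFinM.
Qed.

(** Summing over the second variable first reduces the double sum to a finite
    one. *)
Lemma esum_pair_fst g (k : X -> X -> R) : Cc g -> (forall x, 0 <= g x) ->
  (forall x y, 0 <= k x y) -> (forall x, \esum_(y in setT) (k x y)%:E < +oo)%E ->
  (\esum_(z in [set: X * X]) (g z.1 * k z.1 z.2)%:E)%E =
  (\sum_(x \in setT) g x * fine (\esum_(y in setT) (k x y)%:E)%E)%:E.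
Proof.
move=> fg g0 k0 kfin; rewrite -esum_finite_support//; last first.
  move=> x; rewrite mulr_ge0// fine_ge0// esum_ge0// => y _.
  by rewrite lee_fin.
have -> : [set: X * X] = [set: X] `*`` (fun=> [set: X]) by apply/seteqP; split.
rewrite -(@esum_esum _ _ _ _ _ (fun x y => (g x * k x y)%:E)) => [|x y _ _]; last first.
  by rewrite lee_fin mulr_ge0.
apply: eq_esum => x _; rewrite esumZ// EFinM fineK//.
by rewrite ge0_fin_numE// esum_ge0// => y _; rewrite lee_fin.
Qed.

Lemma esum_swap (k : X -> X -> \bar R) :
  (\esum_(z in [set: X * X]) k z.2 z.1)%E = (\esum_(z in [set: X * X]) k z.1 z.2)%E.
Proof.
rewrite [RHS](@reindex_esum _ _ _ setT setT (fun z => (z.2, z.1)))//.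
split=> //; first by move=> [x y] [x' y'] _ _ /= [-> ->].
by move=> [x y] _; exists (y, x).
Qed.

End FiniteSupport.

(** * The ground state representation *)

Section GroundStateRepresentation.
Context {R : realType} {X : choiceType} (b : X -> X -> R) (b_graph : is_graph b).
Implicit Types (p f phi : X -> R).

Let b_ge0 := graph_ge0 b_graph.

Definition degree x : R := fine (\esum_(y in setT) (b x y)%:E)%E.

Definition neighbour_sum f x : R := fine (\esum_(y in setT) (b x y * f y)%:E)%E.

Lemma neighbour_esum_lty f x : formal_domain b f -> (forall x, 0 <= f x) ->
  (\esum_(y in setT) (b x y * f y)%:E < +oo)%E.
Proof.
move=> /(_ x) + f0; congr (_ < _)%E; apply: eq_esum => y _.
by rewrite ger0_norm.
Qed.

Lemma formal_opE p f x : formal_domain b f -> (forall x, 0 <= f x) ->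
  formal_op b p f x = degree x * f x - neighbour_sum f x + p x * f x.
Proof.
move=> fF f0; rewrite /formal_op; congr (_ + _); rewrite /rsum.
have h1 := graph_sum b_graph x; have h2 := neighbour_esum_lty x fF f0.
have e1 : (\esum_(y in setT) (f x * b x y)%:E)%E = (f x * degree x)%:E.
  rewrite esumZ// EFinM fineK// ge0_fin_numE// esum_ge0// => y _.
  by rewrite lee_fin.
have -> : EFin \o (fun y => b x y * (f x - f y)) =
    ((fun y => (f x * b x y)%:E) \- (fun y => (b x y * f y)%:E))%E.
  by apply/funext => y /=; rewrite mulrBr mulrC EFinB.
rewrite esumB.
- rewrite e1 fineB//= 1?mulrC// ge0_fin_numE// esum_ge0// => y _.
  by rewrite lee_fin mulr_ge0.
- rewrite /summable; under eq_esum do rewrite gee0_abs ?lee_fin ?mulr_ge0//.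
  by rewrite e1 ltry.
- by rewrite /summable; under eq_esum do rewrite gee0_abs ?lee_fin ?mulr_ge0//.
- by move=> y _; rewrite lee_fin mulr_ge0.
- by move=> y _; rewrite lee_fin mulr_ge0.
Qed.

(** With [quotient_diff], the data of Doob's [f]-transform of the form: the
    squared norm of [quotient_diff f phi] for this weight is the energy of
    [phi / f] on the graph [b x y * f x * f y].  The factor [1/2] compensates
    for every edge being counted in both directions. *)
Definition edge_weight f (z : X * X) : R :=
  2^-1 * (b z.1 z.2 * (f z.1 * f z.2)).

Definition quotient_diff f phi (z : X * X) : R :=
  phi z.1 / f z.1 - phi z.2 / f z.2.

Lemma edge_weight_ge0 f z : (forall x, 0 <= f x) -> 0 <= edge_weight f z.
Proof. by move=> f0; rewrite /edge_weight !mulr_ge0// invr_ge0. Qed.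

(** The identity holds edge by edge after expanding squares.  Its mixed terms
    are signed, so each is moved to the side where it is nonnegative and the
    sums can be taken in the extended reals; subtracting is left to the end,
    when all of them are known to be finite. *)
Lemma ground_state_representation p f phi :
  formal_domain b f -> (forall x, 0 < f x) -> Cc phi ->
  ell2 (edge_weight f) (quotient_diff f phi) /\
  graph_form b p phi = wnorm (edge_weight f) (quotient_diff f phi) ^+ 2 +
    \sum_(x \in setT) formal_op b p f x / f x * phi x ^+ 2.
Proof.
move=> fF f_gt0 fphi; have f0 x : 0 <= f x := ltW (f_gt0 x).
have fphi2 := Cc_sqr fphi; have pb z : 0 <= b z.1 z.2 := b_ge0 _ _.
pose S2 := (\esum_(z in [set: X * X]) (b z.1 z.2 * (phi z.1 - phi z.2) ^+ 2)%:E)%E.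
pose T := wnorm2 (edge_weight f) (quotient_diff f phi).
pose A := \sum_(x \in setT) phi x ^+ 2 * degree x.
pose B := \sum_(x \in setT) phi x ^+ 2 * ((f x)^-1 * neighbour_sum f x).
have SA : (\esum_(z in [set: X * X]) (phi z.1 ^+ 2 * b z.1 z.2)%:E = A%:E)%E.
  by apply: esum_pair_fst => // x; [rewrite sqr_ge0|exact: graph_sum].
have SA' : (\esum_(z in [set: X * X]) (phi z.2 ^+ 2 * b z.1 z.2)%:E = A%:E)%E.
  rewrite -SA.
  apply: eq_trans (esum_swap (fun x y => (phi x ^+ 2 * b x y)%:E)).
  apply: eq_esum => z _ /=.
  by rewrite (graph_sym b_graph).
have SB : (\esum_(z in [set: X * X])
    (phi z.1 ^+ 2 * ((f z.1)^-1 * (b z.1 z.2 * f z.2)))%:E = B%:E)%E.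
  rewrite (@esum_pair_fst _ _ (fun x => phi x ^+ 2)
    (fun x y => (f x)^-1 * (b x y * f y)))//.
  - congr EFin; apply: eq_fsbigr => x _; rewrite esumZ ?invr_ge0//; last first.
      by move=> y; rewrite mulr_ge0.
    rewrite fineM//= ge0_fin_numE ?neighbour_esum_lty// esum_ge0// => y _.
    by rewrite lee_fin mulr_ge0.
  - by move=> x; rewrite sqr_ge0.
  - by move=> x y; rewrite !mulr_ge0// invr_ge0.
  - move=> x; rewrite esumZ ?invr_ge0//; last by move=> y; rewrite mulr_ge0.
    by apply: lte_mul_pinfty; rewrite ?lee_fin ?invr_ge0// neighbour_esum_lty.
have SB' : (\esum_(z in [set: X * X])
    (phi z.2 ^+ 2 * ((f z.2)^-1 * (b z.1 z.2 * f z.1)))%:E = B%:E)%E.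
  rewrite -SB.
  apply: eq_trans (esum_swap
    (fun x y => (phi x ^+ 2 * ((f x)^-1 * (b x y * f y)))%:E)).
  apply: eq_esum => z _ /=.
  by rewrite (graph_sym b_graph).
have S20 : (0 <= S2)%E.
  by apply: esum_ge0 => z _; rewrite lee_fin mulr_ge0 ?sqr_ge0.
have T0 : (0 <= T)%E by apply: wnorm2_ge0 => z; exact: edge_weight_ge0.
have p1 z : 0 <= phi z.1 ^+ 2 * b z.1 z.2 by rewrite mulr_ge0 ?sqr_ge0.
have p2 z : 0 <= phi z.2 ^+ 2 * b z.1 z.2 by rewrite mulr_ge0 ?sqr_ge0.
(* Edge by edge this is [b x y] times the identity
   [(phi x - phi y)^2 + phi x^2 f y / f x + phi y^2 f x / f y
    = f x f y (phi x / f x - phi y / f y)^2 + phi x^2 + phi y^2]. *)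
have main : (S2 + (B%:E + B%:E) = T + T + (A%:E + A%:E))%E.
  have pw z := edge_weight_ge0 z f0.
  have if0 x : 0 <= (f x)^-1 by rewrite invr_ge0.
  have r1 z : 0 <= phi z.1 ^+ 2 * ((f z.1)^-1 * (b z.1 z.2 * f z.2)).
    by rewrite mulr_ge0 ?sqr_ge0 ?mulr_ge0.
  have r2 z : 0 <= phi z.2 ^+ 2 * ((f z.2)^-1 * (b z.1 z.2 * f z.1)).
    by rewrite mulr_ge0 ?sqr_ge0 ?mulr_ge0.
  have r3 z : 0 <= b z.1 z.2 * (phi z.1 - phi z.2) ^+ 2.
    by rewrite mulr_ge0 ?sqr_ge0.
  have r4 z : 0 <= edge_weight f z * quotient_diff f phi z ^+ 2.
    by rewrite mulr_ge0 ?sqr_ge0.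
  rewrite -{1}SB -SB' -{1}SA -SA' /S2 /T /wnorm2.
  rewrite -!esumD; do ?[by move=> z _; rewrite -?EFinD lee_fin ?addr_ge0].
  apply: eq_esum => -[x y] _ /=; rewrite -!EFinD; congr EFin.
  by rewrite /edge_weight /quotient_diff/=; field; rewrite !gt_eqF.
have S2fin : (S2 < +oo)%E.
  have : (S2 <= (A%:E + A%:E) + (A%:E + A%:E))%E.
    rewrite -{1}SA -{1}SA' -{1}SA -SA' -!esumD;
      do ?[by move=> z _; rewrite -?EFinD lee_fin ?addr_ge0].
    apply: le_esum => -[x y] _ /=; rewrite -!EFinD lee_fin -!mulrDl mulrC.
    by rewrite ler_wpM2r//; have := sqr_ge0 (phi x + phi y); nra.
  by move=> /le_lt_trans; apply; rewrite -!EFinD ltry.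
have T2 : ell2 (edge_weight f) (quotient_diff f phi).
  rewrite /ell2/= -/T; apply: (@le_lt_trans _ _ (S2 + (B%:E + B%:E))%E).
    have A0 : 0 <= A.
      apply: fsumr_ge0 => x _; rewrite mulr_ge0 ?sqr_ge0// fine_ge0// esum_ge0//.
      by move=> y _; rewrite lee_fin.
    by rewrite main -addeA leeDl// adde_ge0// -EFinD lee_fin addr_ge0.
  by rewrite lte_add_pinfty// -EFinD ltry.
split=> //; have w0 z := edge_weight_ge0 z f0.
have S2E : S2 = (fine S2)%:E by rewrite fineK// ge0_fin_numE.
move: main; rewrite S2E /T (ell2E w0 T2) -!EFinD => -[main].
rewrite /graph_form -/S2.
have -> : \sum_(x \in setT) formal_op b p f x / f x * phi x ^+ 2 =
    A - B + \sum_(x \in setT) p x * phi x ^+ 2.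
  rewrite /A /B -fsumB// [X in _ + X](_ : _ =
    \sum_(x \in setT) phi x ^+ 2 * p x); last first.
    by apply: eq_fsbigr => x _; rewrite mulrC.
  rewrite -fsumD//; apply: eq_fsbigr => x _; rewrite formal_opE//.
  by field; rewrite gt_eqF.
lra.
Qed.

End GroundStateRepresentation.

(** * Superharmonic functions and critical forms *)

Section NonnegativeFunctions.
Context {R : realType} {X : choiceType} (b : X -> X -> R) (b_graph : is_graph b).
Hypothesis b_conn : graph_connected b.
Implicit Types (p f phi : X -> R).

(** At a zero of [f >= 0] the operator is minus the weighted sum of the values
    of [f] at the neighbours, so these vanish too; by connectedness the zero
    would reach [o]. *)
Lemma superharmonic_gt0 p o f : is_ground_state b p o f -> forall x, 0 < f x.
Proof.
move=> [fF f0 _ Af fo] x; rewrite lt_neqAle f0 andbT eq_sym; apply/eqP => fx.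
have step y z : 0 < b y z -> f y = 0 -> f z = 0.
  move=> byz fy; have := Af y; rewrite formal_opE// fy !mulr0 sub0r addr0.
  rewrite oppr_ge0 => le0.
  have := @esum_ge _ _ [set: X] (fun t => (b y t * f t)%:E) (b y z * f z)%:E.
  have -> : (\esum_(t in setT) (b y t * f t)%:E)%E = (neighbour_sum b f y)%:E.
    rewrite fineK// ge0_fin_numE ?neighbour_esum_lty// esum_ge0// => t _.
    by rewrite lee_fin mulr_ge0// (graph_ge0 b_graph).
  rewrite lee_fin => /(_ _)/le_trans/(_ le0) H.
  have : b y z * f z <= 0.
    by apply: H; exists [set z]; [split|rewrite fsbig_set1].
  by rewrite pmulr_rle0// => fz; apply/eqP; rewrite eq_le fz f0.
have walk s : forall y, f y = 0 -> path (fun y z => 0 < b y z) y s ->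
    f (last y s) = 0.
  by elim: s => [//|z s IH] y fy /= /andP[byz] /IH; apply; exact: step fy.
have [s [xs so]] := b_conn x o.
by have := walk s x fx xs; rewrite so fo => /eqP; rewrite oner_eq0.
Qed.

(** Along an edge the quotient changes by at most a multiple of the square root
    of the energy, and every vertex is joined to [o] by finitely many edges. *)
Lemma null_energy_cvg f o (U : nat -> X -> R) (k : R) : (forall x, 0 < f x) ->
  (forall n, ell2 (edge_weight b f) (quotient_diff f (U n))) ->
  wnorm (edge_weight b f) (quotient_diff f (U n)) @[n --> \oo] --> (0 : R) ->
  U n o / f o @[n --> \oo] --> k ->
  forall x, U n x / f x @[n --> \oo] --> k.
Proof.
move=> f_gt0 U2 U0 Uo.
have w0 z : 0 <= edge_weight b f z.
  by apply: edge_weight_ge0 => // x; exact: ltW.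
have step y z : 0 < b y z -> U n y / f y @[n --> \oo] --> k ->
    U n z / f z @[n --> \oo] --> k.
  move=> byz Uy; have wyz : 0 < edge_weight b f (y, z).
    by rewrite /edge_weight/= !mulr_gt0// invr_gt0.
  have := wnorm_cvg0 w0 wyz U2 U0 => d0.
  rewrite -[k]subr0; have -> : (fun n => U n z / f z) =
      (fun n => U n y / f y - quotient_diff f (U n) (y, z)).
    by apply/funext => n; rewrite /quotient_diff/= subKr.
  exact: cvgB.
have walk s : forall y, U n y / f y @[n --> \oo] --> k ->
    path (fun y z => 0 < b y z) y s ->
    U n (last y s) / f (last y s) @[n --> \oo] --> k.
  by elim: s => [//|z s IH] y Uy /= /andP[byz] /IH; apply; exact: step Uy.
by move=> x; have [s [os <-]] := b_conn o x; exact: walk.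
Qed.

End NonnegativeFunctions.

Lemma quotient_diffB {R : realType} {X : choiceType} (f u v : X -> R) :
  quotient_diff f (fun x => u x - v x) =
  (fun z => quotient_diff f u z - quotient_diff f v z).
Proof. by apply/funext => z; rewrite /quotient_diff; ring. Qed.

Lemma quotient_diffD {R : realType} {X : choiceType} (f u v : X -> R) :
  quotient_diff f (fun x => u x + v x) =
  (fun z => quotient_diff f u z + quotient_diff f v z).
Proof. by apply/funext => z; rewrite /quotient_diff; ring. Qed.

Section Critical.
Context {R : realType} {X : choiceType} (b : X -> X -> R) (b_graph : is_graph b).
Hypothesis b_conn : graph_connected b.
Variables (p : X -> R) (o : X) (psi : X -> R).
Hypotheses (p_crit : critical b p) (psi_gs : is_ground_state b p o psi).
Implicit Types (phi : X -> R).

Let psi_gt0 := superharmonic_gt0 b_graph b_conn psi_gs.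
Let psiF : formal_domain b psi. Proof. by case: psi_gs. Qed.
Let psio : psi o = 1. Proof. by case: psi_gs. Qed.

Local Notation ew := (edge_weight b psi).
Local Notation qd := (quotient_diff psi).

Lemma edge_weight_psi_ge0 z : 0 <= ew z.
Proof. by apply: edge_weight_ge0 => // x; exact: ltW. Qed.

(** Otherwise [A psi / psi] would witness subcriticality: subtracting it from
    the form leaves exactly the energy. *)
Lemma ground_state_harmonic : formal_op b p psi = cst 0.
Proof.
apply: contrapT => Apsi; case: p_crit => _; apply.
exists (fun x => formal_op b p psi x / psi x); split.
- by move=> x; rewrite divr_ge0 ?(ltW (psi_gt0 x))//; case: psi_gs.
- move=> A0; apply: Apsi; apply/funext => x; have /(congr1 (@^~ x)) := A0.
  by move=> /eqP; rewrite /= mulf_eq0 invr_eq0 (gt_eqF (psi_gt0 x)) orbF => /eqP.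
- move=> phi fphi; rewrite graph_form_potentialB//.
  have [_ ->] := ground_state_representation b_graph p psiF psi_gt0 fphi.
  by rewrite addrK sqr_ge0.
Qed.

Lemma energyE phi : Cc phi -> ell2 ew (qd phi) /\
  graph_form b p phi = wnorm ew (qd phi) ^+ 2.
Proof.
move=> fphi.
have [e2 ->] := ground_state_representation b_graph p psiF psi_gt0 fphi.
split=> //; rewrite ground_state_harmonic fsbig1 ?addr0// => x _.
by rewrite !mul0r.
Qed.

(** Criticality tested with the weight [d ^+ 2] at [o]. *)
Lemma small_energy (d : R) : 0 < d -> exists phi,
  [/\ Cc phi, phi o != 0 & wnorm ew (qd phi) < d * `|phi o|].
Proof.
move=> d0; apply: contrapT => nex; case: p_crit => _; apply.
exists (fun x => if x == o then d ^+ 2 else 0); split.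
- by move=> x; case: ifP => // _; rewrite sqr_ge0.
- move=> /(congr1 (@^~ o))/=; rewrite eqxx => /eqP.
  by rewrite expf_eq0/= gt_eqF.
- move=> phi fphi; rewrite graph_form_potentialB//.
  have [e2 ->] := energyE fphi.
  have -> : \sum_(x \in setT) (if x == o then d ^+ 2 else 0) * phi x ^+ 2 =
      d ^+ 2 * phi o ^+ 2.
    rewrite -(@fsbig_widen _ _ _ _ [set o])//; first by rewrite fsbig_set1 eqxx.
    by move=> x /= [_ /eqP/negbTE ->]; rewrite mul0r.
  rewrite subr_ge0 -exprMn -[leLHS]real_normK ?num_real// normrM (gtr0_norm d0).
  rewrite ler_sqr ?nnegrE ?wnorm_ge0 ?mulr_ge0 ?(ltW d0)// leNgt.
  apply/negP => lt; apply: nex; exists phi; split=> //.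
  apply: contraTN lt => /eqP ->; rewrite normr0 mulr0 -leNgt.
  exact: wnorm_ge0.
Qed.

(** Clipping [phi / psi] to the unit interval does not increase the energy. *)
Let clip (r : R) := Num.min 1 (Num.max 0 r).

Let clip_contract r s : `|clip r - clip s| <= `|r - s|.
Proof.
have := ler_norm (r - s); have := ler_norm (s - r); rewrite (distrC s) => h1 h2.
rewrite /clip ler_norml; case: (lerP 0 r) => ?; case: (lerP 0 s) => ?;
  case: (lerP 1 r) => ?; case: (lerP 1 s) => ?; case: (lerP 1 (0 : R)) => ?;
  apply/andP; split; lra.
Qed.

Lemma null_sequence : exists E : nat -> X -> R,
  [/\ forall n, Cc (E n), forall n x, 0 <= E n x <= psi x,
      forall n, E n o = 1 &
      wnorm ew (qd (E n)) @[n --> \oo] --> (0 : R)].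
Proof.
have ex (n : nat) : exists e, [/\ Cc e, forall x, 0 <= e x <= psi x, e o = 1 &
    wnorm ew (qd e) <= n.+1%:R^-1].
  have [|phi [fphi phio lt]] := @small_energy n.+1%:R^-1; first by rewrite invr_gt0.
  exists (fun x => psi x * clip ((phi o)^-1 * (phi x / psi x))).
  split.
  - apply: sub_finite_set fphi => x /=; apply: contraNneq => ->.
    by rewrite mul0r mulr0 /clip maxxx minEle ler10 mulr0.
  - move=> x; have px := ltW (psi_gt0 x); rewrite mulr_ge0//=; last first.
      by rewrite /clip le_min ler01 le_max lexx.
    by rewrite ler_piMr// /clip ge_min lexx.
  - by rewrite psio divr1 mulVf// mul1r /clip (max_idPr ler01) minxx.
  - have [p2 _] := energyE fphi.
    have [s2 sle] := wnorm_scale edge_weight_psi_ge0 (phi o)^-1 p2.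
    have [|_ le] := wnorm_le edge_weight_psi_ge0 s2 (_ : forall z,
        `|qd (fun x => psi x * clip ((phi o)^-1 * (phi x / psi x))) z| <= _).
      move=> z; rewrite {1}/quotient_diff !(mulrC (psi _)) !mulfK ?gt_eqF//.
      by apply: le_trans (clip_contract _ _) _; rewrite -mulrBr.
    apply: le_trans le _; apply: le_trans sle _.
    by rewrite normfV ler_pdivrMl ?normr_gt0// mulrC ltW.
have /choice[E HE] := ex; exists E; split; try by move=> n; case: (HE n).
apply: (@squeeze_cvgr _ _ _ _ (cst 0) harmonic).
- by near=> n; case: (HE n) => _ _ _ le; rewrite wnorm_ge0 le.
- exact: cvg_cst.
- exact: cvg_harmonic.
Unshelve. all: by end_near. Qed.

Lemma null_sequence_cvg (E : nat -> X -> R) : (forall n, Cc (E n)) ->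
  (forall n, E n o = 1) -> wnorm ew (qd (E n)) @[n --> \oo] --> (0 : R) ->
  forall x, E n x @[n --> \oo] --> psi x.
Proof.
move=> fE Eo E0 x; have /(_ x) cE : forall x, E n x / psi x @[n --> \oo] --> (1 : R).
  apply: (null_energy_cvg b_graph b_conn psi_gt0 _ E0 (o := o)).
    by move=> n; exact: (energyE (fE n)).1.
  by under eq_fun do rewrite Eo psio divr1; exact: cvg_cst.
have -> : (fun n => E n x) = (fun n => E n x / psi x * psi x).
  by apply/funext => n; rewrite mulfVK// gt_eqF.
suff : E n x / psi x * psi x @[n --> \oo] --> 1 * psi x by rewrite mul1r.
by apply: cvgM => //; exact: cvg_cst.
Qed.

(** A constant sequence is a null sequence for the energy. *)
Lemma zero_energy_multiple f : ell2 ew (qd f) -> wnorm ew (qd f) = 0 ->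
  forall x, f x = f o * psi x.
Proof.
move=> f2 f0 x; have /(_ x) cE : forall x, f x / psi x @[_ --> \oo] --> f o.
  apply: (null_energy_cvg b_graph b_conn psi_gt0 (fun=> f2) _ (o := o)).
    by rewrite f0; exact: cvg_cst.
  by rewrite psio divr1; exact: cvg_cst.
have : f x / psi x = f o by apply: cvg_unique cE => //; exact: cvg_cst.
by move=> <-; rewrite mulfVK// gt_eqF.
Qed.

End Critical.

(** * Energy convergence and extended forms *)

Section Cauchy.
Context {R : realType}.

Lemma cauchy_dom (X I J : choiceType) (N : (X -> R) -> R) (N1 : (I -> R) -> R)
    (N2 : (J -> R) -> R) Phi U V :
  cauchy_for N1 U -> cauchy_for N2 V ->
  (forall m n, N (fun x => Phi m x - Phi n x) <=
     N1 (fun i => U m i - U n i) + N2 (fun j => V m j - V n j)) ->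
  cauchy_for N Phi.
Proof.
move=> cU cV le e e0; have e20 : 0 < e / 2 by rewrite divr_gt0.
have [N0 H0] := cU _ e20; have [N0' H0'] := cV _ e20.
exists (maxn N0 N0') => m n; rewrite !geq_max => /andP[m1 m2] /andP[n1 n2].
rewrite (le_lt_trans (le _ _))// [e]splitr.
by apply: ltrD; [exact: H0|exact: H0'].
Qed.

Lemma cauchy_le (X I : choiceType) (N : (X -> R) -> R) (N1 : (I -> R) -> R) Phi U :
  cauchy_for N1 U -> (forall m n, N (fun x => Phi m x - Phi n x) <=
     N1 (fun i => U m i - U n i)) -> cauchy_for N Phi.
Proof.
move=> cU le e e0; have [N0 H0] := cU _ e0.
by exists N0 => m n m0 n0; rewrite (le_lt_trans (le _ _))// H0.
Qed.

Lemma wnorm_cvg_cauchy (I : choiceType) (c : I -> R) U u :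
  (forall i, 0 <= c i) -> (forall n, ell2 c (U n)) -> ell2 c u ->
  wnorm c (fun i => U n i - u i) @[n --> \oo] --> (0 : R) ->
  cauchy_for (wnorm c) U.
Proof.
move=> c0 U2 u2 U0 e e0; have e20 : 0 < e / 2 by rewrite divr_gt0.
have /cvgr_lt/(_ (e / 2) e20)[N _ NU] := U0.
exists N => m n mN nN.
have [dm2 _] := wnormB c0 (U2 m) u2; have [dn2 _] := wnormB c0 (U2 n) u2.
have [_] := wnormB c0 dm2 dn2.
rewrite (_ : (fun i => _) = (fun i => U m i - U n i)); last first.
  by apply/funext => i; ring.
move=> /le_lt_trans; apply; rewrite [e]splitr.
by apply: ltrD; apply: NU.
Qed.

End Cauchy.

Section SquareRoots.
Context {R : rcfType}.

Lemma le_sqrt (x y : R) : 0 <= x -> x ^+ 2 <= y -> x <= Num.sqrt y.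
Proof. by move=> x0 /ler_wsqrtr; rewrite sqrtr_sqr ger0_norm. Qed.

Lemma sqrt_sqrD_le (x y : R) : 0 <= x -> 0 <= y ->
  Num.sqrt (x ^+ 2 + y ^+ 2) <= x + y.
Proof.
move=> x0 y0; rewrite -[leRHS]ger0_norm ?addr_ge0// -sqrtr_sqr.
by apply: ler_wsqrtr; nra.
Qed.

End SquareRoots.

Section CcSpace.
Context {R : realType} {X : choiceType}.
Implicit Types (w phi : X -> R).

Lemma CcD phi phi' : Cc phi -> Cc phi' -> Cc (fun x => phi x + phi' x).
Proof.
move=> f1 f2; apply: sub_finite_set (_ : finite_set
  ([set x | phi x != 0] `|` [set x | phi' x != 0])); last by rewrite finite_setU.
move=> x /=; have [->|] := eqVneq (phi x) 0; last by left.
by rewrite add0r; right.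
Qed.

Lemma CcN phi : Cc phi -> Cc (fun x => - phi x).
Proof. by apply: sub_finite_set => x /=; rewrite oppr_eq0. Qed.

Lemma CcB phi phi' : Cc phi -> Cc phi' -> Cc (fun x => phi x - phi' x).
Proof. by move=> f1 /CcN; exact: CcD. Qed.

Lemma Cc_wnorm w phi : (forall x, 0 <= w x) -> Cc phi ->
  ell2 w phi /\ \sum_(x \in setT) w x * phi x ^+ 2 = wnorm w phi ^+ 2.
Proof.
move=> w0 fphi; have swap : \sum_(x \in setT) w x * phi x ^+ 2 =
    \sum_(x \in setT) phi x ^+ 2 * w x by apply: eq_fsbigr => x _; rewrite mulrC.
have wE : wnorm2 w phi = (\sum_(x \in setT) w x * phi x ^+ 2)%:E.
  rewrite swap -esum_finite_support; last 2 first.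
  - exact: Cc_sqr.
  - by move=> x; rewrite mulr_ge0 ?sqr_ge0.
  by apply: eq_esum => x _; rewrite mulrC.
have w2 : ell2 w phi by rewrite /ell2/= wE ltry.
by split=> //; apply: EFin_inj; rewrite -wE ell2E.
Qed.

End CcSpace.

Section EnergySpace.
Context {R : realType} {X : choiceType} (b : X -> X -> R) (b_graph : is_graph b).
Hypothesis b_conn : graph_connected b.
Variables (q w : X -> R) (o : X) (psi : X -> R).
Hypotheses (w_ge0 : forall x, 0 <= w x) (w_neq0 : w <> cst 0).
Hypothesis hw_crit : critical b (fun x => q x - w x).
Hypothesis psi_gs : is_ground_state b (fun x => q x - w x) o psi.
Implicit Types (f g phi : X -> R) (Phi Psi : nat -> X -> R).

Let h := graph_form b q.
Let a := graph_form b (fun x => q x - w x).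
Let psi_gt0 := superharmonic_gt0 b_graph b_conn psi_gs.
Let psio : psi o = 1. Proof. by case: psi_gs. Qed.

Local Notation ew := (edge_weight b psi).
Local Notation qd := (quotient_diff psi).

Let ew_ge0 z : 0 <= ew z. Proof. exact: edge_weight_psi_ge0 psi_gs _. Qed.
Let qd2 phi : Cc phi -> ell2 ew (qd phi).
Proof. by move=> /(energyE b_graph b_conn hw_crit psi_gs)[]. Qed.
Let aE phi : Cc phi -> a phi = wnorm ew (qd phi) ^+ 2.
Proof. by move=> /(energyE b_graph b_conn hw_crit psi_gs)[]. Qed.

Lemma hE phi : Cc phi -> h phi = wnorm ew (qd phi) ^+ 2 + wnorm w phi ^+ 2.
Proof.
move=> fphi; rewrite -aE// /a graph_form_potentialB//.
by rewrite (Cc_wnorm w_ge0 fphi).2 subrK.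
Qed.

(** Convergence in the two norms whose squares add up to [h].  Sequences
    approximating in the sense of [D_space] or of the closure of [a] have this
    property, and the extended forms can be read off from it. *)
Definition energy_cvg Phi f : Prop :=
  [/\ forall n, Cc (Phi n), ell2 ew (qd f), ell2 w f,
      wnorm ew (fun z => qd (Phi n) z - qd f z) @[n --> \oo] --> (0 : R) &
      wnorm w (fun x => Phi n x - f x) @[n --> \oo] --> (0 : R)].

Lemma energy_cvg_a Phi f : energy_cvg Phi f ->
  a \o Phi @ \oo --> wnorm ew (qd f) ^+ 2.
Proof.
move=> [fPhi f2 _ cPhi _].
rewrite (_ : a \o Phi = (fun n => wnorm ew (qd (Phi n)) * wnorm ew (qd (Phi n)))).
  by rewrite expr2; apply: cvgM; apply: wnorm_cvg => // n; exact: qd2.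
by apply/funext => n /=; rewrite aE.
Qed.

Lemma energy_cvg_h Phi f : energy_cvg Phi f ->
  h \o Phi @ \oo --> wnorm ew (qd f) ^+ 2 + wnorm w f ^+ 2.
Proof.
move=> [fPhi f2 w2 cPhi cwPhi].
rewrite (_ : h \o Phi = (fun n => (a \o Phi) n + wnorm w (Phi n) * wnorm w (Phi n))).
  apply: cvgD; first exact: energy_cvg_a.
  rewrite expr2; apply: cvgM; apply: wnorm_cvg => // n;
    exact: (Cc_wnorm w_ge0 (fPhi n)).1.
by apply/funext => n /=; rewrite hE// aE.
Qed.

Lemma energy_cvgD Phi f Psi g : energy_cvg Phi f -> energy_cvg Psi g ->
  energy_cvg (fun n x => Phi n x + Psi n x) (fun x => f x + g x).
Proof.
move=> [fPhi f2 wf2 cf cwf] [fPsi g2 wg2 cg cwg].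
have sum0 (I : choiceType) (c : I -> R) (U V : nat -> I -> R) u v :
    (forall i, 0 <= c i) -> (forall n, ell2 c (U n)) -> (forall n, ell2 c (V n)) ->
    ell2 c u -> ell2 c v ->
    wnorm c (fun i => U n i - u i) @[n --> \oo] --> (0 : R) ->
    wnorm c (fun i => V n i - v i) @[n --> \oo] --> (0 : R) ->
    wnorm c (fun i => U n i + V n i - (u i + v i)) @[n --> \oo] --> (0 : R).
  move=> c0 U2 V2 u2 v2 Uu Vv.
  apply: (@squeeze_cvgr _ _ _ _ (cst 0) (fun n =>
    wnorm c (fun i => U n i - u i) + wnorm c (fun i => V n i - v i))).
  - near=> n; rewrite wnorm_ge0/=.
    have [_] := wnormD c0 (wnormB c0 (U2 n) u2).1 (wnormB c0 (V2 n) v2).1.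
    apply: le_trans; rewrite le_eqVlt; apply/orP; left; apply/eqP.
    by apply: eq_wnorm => i; congr `|_|; ring.
  - exact: cvg_cst.
  - by rewrite -[0 in X in _ --> X](addr0 0); exact: cvgD.
split.
- by move=> n; exact: CcD.
- by rewrite quotient_diffD; exact: (wnormD _ _ _).1.
- exact: (wnormD _ _ _).1.
- rewrite quotient_diffD; under eq_fun do rewrite quotient_diffD.
  by apply: sum0 => // n; exact: qd2.
- by apply: sum0 => // n; apply: (Cc_wnorm w_ge0 _).1.
Unshelve. all: by end_near. Qed.

Lemma quotient_diffN f : qd (fun x => - f x) = (fun z => - qd f z).
Proof. by apply/funext => z; rewrite /quotient_diff; ring. Qed.

Lemma energy_cvgN Phi f : energy_cvg Phi f ->
  energy_cvg (fun n x => - Phi n x) (fun x => - f x).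
Proof.
move=> [fPhi f2 wf2 cf cwf]; split.
- by move=> n; exact: CcN.
- by rewrite quotient_diffN; exact: ell2N.
- exact: ell2N.
- apply: cvg_trans cf; apply: near_eq_cvg; near=> n.
  rewrite !quotient_diffN; apply: eq_wnorm => z.
  by rewrite -opprD normrN.
- apply: cvg_trans cwf; apply: near_eq_cvg; near=> n.
  by apply: eq_wnorm => z; rewrite -opprD normrN.
Unshelve. all: by end_near. Qed.

Lemma qd_cvg Phi f : (forall x, Phi n x @[n --> \oo] --> f x) ->
  forall z, qd (Phi n) z @[n --> \oo] --> qd f z.
Proof.
by move=> Pf z; apply: cvgB; apply: cvgM; do ?[exact: Pf|exact: cvg_cst].
Qed.

Lemma D_approx_energy Phi f : D_approx h o Phi f -> energy_cvg Phi f.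
Proof.
move=> [fPhi cPhi Pf].
have le m n : wnorm ew (fun z => qd (Phi m) z - qd (Phi n) z) <=
      form_norm h o (fun x => Phi m x - Phi n x) /\
    wnorm w (fun x => Phi m x - Phi n x) <=
      form_norm h o (fun x => Phi m x - Phi n x).
  rewrite -quotient_diffB /form_norm hE; last exact: CcB.
  split; apply: le_sqrt; rewrite ?wnorm_ge0//.
    by rewrite -addrA lerDl addr_ge0 ?sqr_ge0.
  by rewrite addrAC lerDr addr_ge0 ?sqr_ge0.
have [f2 cf] := cauchy_wnorm_cvg ew_ge0 (qd_cvg Pf) (fun n => qd2 (fPhi n))
  (cauchy_le cPhi (fun m n => (le m n).1)).
have [wf2 cwf] := cauchy_wnorm_cvg w_ge0 Pf
  (fun n => (Cc_wnorm w_ge0 (fPhi n)).1) (cauchy_le cPhi (fun m n => (le m n).2)).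
by split.
Qed.

(** For [w > 0] convergence in l^2 forces pointwise convergence, which
    identifies the limit of the energies. *)
Lemma closure_approx_energy Phi f : (forall x, 0 < w x) ->
  closure_approx a w Phi f -> energy_cvg Phi f.
Proof.
move=> w_gt0 [wf2 fPhi cPhi cwf].
have wPhi n := (Cc_wnorm w_ge0 (fPhi n)).1.
have Pf x : Phi n x @[n --> \oo] --> f x.
  have := wnorm_cvg0 w_ge0 (w_gt0 x) (fun n => (wnormB w_ge0 (wPhi n) wf2).1) cwf.
  move=> d0; rewrite -[f x]add0r.
  rewrite (_ : (fun n => Phi n x) = (fun n => Phi n x - f x + f x)).
    by apply: cvgD => //; exact: cvg_cst.
  by apply/funext => n; rewrite subrK.
have le m n : wnorm ew (fun z => qd (Phi m) z - qd (Phi n) z) <=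
    closure_norm a w (fun x => Phi m x - Phi n x).
  rewrite -quotient_diffB /closure_norm aE; last exact: CcB.
  by apply: le_sqrt; rewrite ?wnorm_ge0// lerDl sqr_ge0.
have [f2 cf] := cauchy_wnorm_cvg ew_ge0 (qd_cvg Pf) (fun n => qd2 (fPhi n))
  (cauchy_le cPhi le).
by split.
Qed.

Lemma energy_closure_approx Phi f : energy_cvg Phi f -> closure_approx a w Phi f.
Proof.
move=> [fPhi f2 wf2 cf cwf]; have wPhi n := (Cc_wnorm w_ge0 (fPhi n)).1.
split=> //; apply: (cauchy_dom
  (wnorm_cvg_cauchy ew_ge0 (fun n => qd2 (fPhi n)) f2 cf)
  (wnorm_cvg_cauchy w_ge0 wPhi wf2 cwf)) => m n.
rewrite -quotient_diffB /closure_norm aE; last exact: CcB.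
by rewrite sqrt_sqrD_le ?wnorm_ge0.
Qed.

Lemma energy_D_approx Phi f : energy_cvg Phi f ->
  (forall x, Phi n x @[n --> \oo] --> f x) -> (forall n, Phi n o = f o) ->
  D_approx h o Phi f.
Proof.
move=> [fPhi f2 wf2 cf cwf] Pf Pfo; have wPhi n := (Cc_wnorm w_ge0 (fPhi n)).1.
split=> //; apply: (cauchy_dom
  (wnorm_cvg_cauchy ew_ge0 (fun n => qd2 (fPhi n)) f2 cf)
  (wnorm_cvg_cauchy w_ge0 wPhi wf2 cwf)) => m n.
rewrite -quotient_diffB /form_norm hE; last exact: CcB.
by rewrite !Pfo subrr expr0n addr0 sqrt_sqrD_le ?wnorm_ge0.
Qed.

(** The limit of [h] along any approximating sequence is determined by [f]:
    this is the closability of [h], obtained from its sum of squares form. *)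
Lemma form_extE f : D_space h o f -> [/\ ell2 ew (qd f), ell2 w f &
  form_ext h o f = wnorm ew (qd f) ^+ 2 + wnorm w f ^+ 2].
Proof.
move=> [Phi Df]; have Ef := D_approx_energy Df.
split; [by case: Ef|by case: Ef|].
apply: get_unique; first by exists Phi; split=> //; exact: energy_cvg_h.
move=> l [Psi [/D_approx_energy/energy_cvg_h Ph Pl]].
exact: cvg_unique Pl Ph.
Qed.

Lemma closure_formE Phi f : (forall x, 0 < w x) -> energy_cvg Phi f ->
  closure_form a w f = wnorm ew (qd f) ^+ 2.
Proof.
move=> w_gt0 Ef; apply: get_unique.
  by exists Phi; split; [exact: energy_closure_approx|exact: energy_cvg_a].
move=> l [Psi [/(closure_approx_energy w_gt0)/energy_cvg_a Ph Pl]].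
exact: cvg_unique Pl Ph.
Qed.

Lemma quotient_diff_psi : qd psi = cst 0.
Proof.
by apply/funext => z; rewrite /quotient_diff !divff ?gt_eqF// subrr.
Qed.

Lemma wnorm_cst0 (I : choiceType) (c : I -> R) :
  ell2 c (cst 0) /\ wnorm c (cst 0) = 0.
Proof.
have n0 : wnorm2 c (cst 0) = 0%E.
  by apply: esum1 => i _; rewrite /= expr0n/= mulr0.
by split; [rewrite /ell2/= n0|rewrite /wnorm n0 sqrtr0].
Qed.

Lemma psi_energy_cvg : ell2 w psi -> exists Phi, [/\ energy_cvg Phi psi,
  forall x, Phi n x @[n --> \oo] --> psi x & forall n, Phi n o = psi o].
Proof.
move=> w2; have [E [fE Ele Eo E0]] := null_sequence b_graph b_conn hw_crit psi_gs.
have Ep := null_sequence_cvg b_graph b_conn hw_crit psi_gs fE Eo E0.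
exists E; split=> //; last by move=> n; rewrite Eo psio.
split=> //.
- by rewrite quotient_diff_psi; exact: (wnorm_cst0 _).1.
- apply: cvg_trans E0; apply: near_eq_cvg; near=> n.
  by rewrite quotient_diff_psi; apply: eq_wnorm => z; rewrite subr0.
- exact: dominated_wnorm_cvg.
Unshelve. all: by end_near. Qed.

Let w_witness : exists x, 0 < w x.
Proof.
apply: contrapT => nw; apply: w_neq0; apply/funext => x; apply/eqP.
by rewrite eq_le w_ge0 andbT leNgt; apply/negP => wx; apply: nw; exists x.
Qed.

(** The quotients are [1 + energy / ||phi||^2].  If their infimum exceeded [1],
    the weight [(inf - 1) * w] would witness subcriticality. *)
Lemma rayleigh_infE : rayleigh_inf h w = 1.
Proof.
have [x0 wx0] := w_witness; rewrite /rayleigh_inf; set S := [set _ | _ in _].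
have ge1 : lbound S 1.
  move=> _ [phi [fphi phi0] <-]; rewrite hE//.
  by rewrite mulrDl divff ?expf_eq0// lerDr divr_ge0 ?sqr_ge0.
have S0 : S !=set0.
  pose d x : R := (x == x0)%:R; have fd : Cc d.
    apply: sub_finite_set (finite_set1 x0) => x /=; rewrite /d.
    by have [->//|_] := eqVneq x x0; rewrite eqxx.
  exists (h d / wnorm w d ^+ 2); exists d => //; split=> //.
  have [d2 _] := Cc_wnorm w_ge0 fd; have := term_le_wnorm w_ge0 x0 d2.
  rewrite /d eqxx expr1n mulr1 => le; apply: contraTneq le => ->.
  by rewrite expr0n/= -ltNge.
apply/eqP; rewrite eq_le lb_le_inf// andbT leNgt; apply/negP => lt1.
case: hw_crit => _; apply; exists (fun x => (inf S - 1) * w x); split.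
- by move=> x; rewrite mulr_ge0// subr_ge0 ltW.
- move=> /(congr1 (@^~ x0))/= /eqP; rewrite mulf_eq0 (gt_eqF wx0) orbF subr_eq0.
  by move=> /eqP inf1; rewrite inf1 ltxx in lt1.
- move=> phi fphi; rewrite graph_form_potentialB// -/a aE//.
  rewrite (_ : \sum_(x \in _) _ = (inf S - 1) * wnorm w phi ^+ 2); last first.
    rewrite -(Cc_wnorm w_ge0 fphi).2 mulr_fsumr.
    by apply: eq_fsbigr => x _; rewrite -mulrA.
  have [->|phi0] := eqVneq (wnorm w phi) 0.
    by rewrite expr0n/= mulr0 subr0 sqr_ge0.
  have : inf S <= h phi / wnorm w phi ^+ 2.
    by apply: ge_inf; [exists 1|exists phi].
  rewrite hE// ler_pdivlMr; last by rewrite exprn_gt0// lt_def phi0 wnorm_ge0.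
  by rewrite mulrBl mul1r subr_ge0 lerBlDr.
Qed.

Lemma psi_wnorm_neq0 : ell2 w psi -> wnorm w psi != 0.
Proof.
move=> w2; have [x0 wx0] := w_witness.
have := term_le_wnorm w_ge0 x0 w2; apply: contraTneq => ->.
by rewrite expr0n/= -ltNge mulr_gt0// exprn_gt0.
Qed.

Lemma ell2_D_space : ell2 w psi -> D_space h o psi.
Proof.
move=> /psi_energy_cvg[Phi [cP Pp Po]]; exists Phi.
exact: energy_D_approx.
Qed.

(** The minimal value [1] leaves no room for energy, so [v] is a multiple of
    [psi]. *)
Lemma minimizer_ell2 v : D_space h o v -> wnorm w v != 0 ->
  form_ext h o v / wnorm w v ^+ 2 = rayleigh_inf h w -> ell2 w psi.
Proof.
move=> /form_extE[v2 wv2 ->] v0; rewrite rayleigh_infE.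
move=> /(canRL (divfK _)); rewrite expf_eq0 v0 mul1r => /(_ isT).
move=> /(canRL (addrK _)); rewrite subrr => /eqP; rewrite expf_eq0/= => /eqP Ev0.
have vE := zero_energy_multiple b_graph b_conn psi_gs v2 Ev0.
have vo : v o != 0.
  apply: contraNneq v0 => vo; rewrite -(wnorm_cst0 w).2.
  by apply/eqP/eq_wnorm => x; rewrite vE vo mul0r.
have [+ _] := wnorm_scale w_ge0 (v o)^-1 wv2; congr (ell2 _ _).
by apply/funext => x; rewrite (vE x) mulKf.
Qed.

(** The quotient by [psi] of [psi] is constant, so adding [psi] to [k] does not
    change the energy, and the polarised form vanishes. *)
Lemma psi_eigenfunction : (forall x, 0 < w x) -> ell2 w psi ->
  eigenfunction a w 0 psi.
Proof.
move=> w_gt0 w2; have [E [cE _ _]] := psi_energy_cvg w2.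
split; first by case: psi_gs.
have z0 : (fun x => 0 * psi x) = cst 0 by apply/funext => x; rewrite mul0r.
rewrite z0; split; first by exists E; exact: energy_closure_approx.
  exact: (wnorm_cst0 w).1.
move=> k [Phi /(closure_approx_energy w_gt0) ck].
rewrite /closure_bilin (closure_formE w_gt0 (energy_cvgD cE ck)).
rewrite (closure_formE w_gt0 (energy_cvgD cE (energy_cvgN ck))).
rewrite !quotient_diffD quotient_diffN quotient_diff_psi.
rewrite (@eq_wnorm _ _ _ (fun z => cst 0 z - qd k z) (fun z => cst 0 z + qd k z)).
  rewrite subrr mulr0 /wdot /rsum !esum1 ?subee// => x _;
    by rewrite ?funeposE ?funenegE /= mulr0 mul0r ?oppr0 maxxx.
by move=> z; rewrite /= sub0r add0r normrN.
Qed.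

End EnergySpace.

(** * The equivalences *)

Theorem theorem6p2 (R : realType) (X : choiceType) (X_inf : infinite_set [set: X])
  (b : X -> X -> R) (b_graph : is_graph b) (b_conn : graph_connected b)
  (q : X -> R) (o : X)
  (w : X -> R) (w_ge0 : forall x, 0 <= w x) (w_neq0 : w <> cst 0)
  (hw_ge0 : Cc_nonneg (graph_form b (fun x => q x - w x)))
  (hw_crit : critical b (fun x => q x - w x))
  (psi : X -> R) (psi_gs : is_ground_state b (fun x => q x - w x) o psi) :
  let h := graph_form b q in
  let i := positive_critical b (fun x => q x - w x) o psi w in
  let ii := D_space h o psi in
  let iii := D_space h o psi /\ ell2 w psi in
  let iv := exists v : X -> R, [/\ D_space h o v, ell2 w v, wnorm w v != 0 &
    form_ext h o v / wnorm w v ^+ 2 = rayleigh_inf h w] in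
  let v := [/\ D_space h o psi, ell2 w psi, wnorm w psi != 0 &
    form_ext h o psi / wnorm w psi ^+ 2 = rayleigh_inf h w] in
  let vi := eigenfunction (graph_form b (fun x => q x - w x)) w 0 psi in
  [<-> i; ii; iii; iv; v] /\ ((forall x, 0 < w x) -> (i <-> vi)).
Proof.
move=> h i ii iii iv v vi.
have iE : i <-> ell2 w psi.
  have e : (\esum_(x in setT) (psi x ^+ 2 * w x)%:E = wnorm2 w psi)%E.
    by apply: eq_esum => x _; rewrite mulrC.
  by split; [case=> _ _; rewrite e|move=> w2; split=> //; rewrite e].
have D2 : ell2 w psi -> v.
  move=> w2; have Dpsi := ell2_D_space b_graph b_conn w_ge0 hw_crit psi_gs w2.
  have n0 := psi_wnorm_neq0 b_graph b_conn w_ge0 w_neq0 psi_gs w2.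
  split=> //; rewrite (rayleigh_infE b_graph b_conn w_ge0 w_neq0 hw_crit psi_gs).
  have [_ _ ->] := form_extE b_graph b_conn w_ge0 hw_crit psi_gs Dpsi.
  rewrite (quotient_diff_psi b_graph b_conn psi_gs) (wnorm_cst0 _).2.
  by rewrite expr0n add0r divff// expf_eq0.
split; last first.
  move=> w_gt0; split=> [/iE w2|[_ [[Phi [w2 _ _ _]] _ _]]]; last exact/iE.
  exact: (psi_eigenfunction b_graph b_conn w_ge0 hw_crit psi_gs).
tfae.
- by move=> /iE/D2[].
- move=> Dpsi; split=> //.
  by have [] := form_extE b_graph b_conn w_ge0 hw_crit psi_gs Dpsi.
- by move=> [_ /D2 vpsi]; exists psi.
- move=> [u [Du _ u0 uE]]; apply: D2.
  exact: (minimizer_ell2 b_graph b_conn w_ge0 w_neq0 hw_crit psi_gs Du u0 uE).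
- by move=> [_ w2 _ _]; apply/iE.
Qed.
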